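(* Let $0<\omega^*<\infty$ and let the superposition $\gamma(f(\omega))$ be continuous and strictly positive for $0\le\omega<\omega^*$. Suppose that $\lim_{\omega\to\omega^*}\gamma(f(\omega))=\infty$ and that the limit $$\lim_{\omega\to\omega^*}\int_0^{\omega}\frac{d\sigma}{\gamma(f(\sigma))}=T^+$$ exists. Then the Cauchy problem $$\frac{d\omega}{dt}=\gamma(f(\omega(t))),\qquad\omega(0)=0,$$ has a continuous monotone increasing solution $\omega^+(t)$ in the cone $C^+_{[0,T^+]}$ (the differential equation being satisfied for $0\le t<T^+$), and $$\lim_{t\to T^+}\frac{d\omega^+}{dt}=+\infty.$$ The approximations $$\omega_n(t)=\int_0^t\gamma(f(\omega_{n-1}(s)))\,ds,\qquad\omega_0=0,$$ converge to the solution $\omega^+(t)$ for $0\le t\le T^+$.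
   Context: $f$ and $\gamma$ are real-valued monotone increasing continuous functions of a real variable whose superposition $\gamma(f(\omega))$ is defined for $0\le\omega<\omega^*$ (in particular it is monotone increasing there). $C^+_{[0,T^+]}$ is the cone of continuous nonnegative real functions on $[0,T^+]$. *)

(* Defs.v *)
From mathcomp Require Import all_boot all_order all_algebra.
From mathcomp Require Import all_classical all_reals all_analysis.

Set Implicit Arguments.
Unset Strict Implicit.
Unset Printing Implicit Defensive.

Import Order.TTheory GRing.Theory Num.Theory.
Import numFieldNormedType.Exports.

Local Open Scope classical_set_scope.
Local Open Scope ring_scope.

Definition nonneg_cone (R : realType) (T : R) : set (R -> R) :=
  [set w : R -> R | {within `[0, T], continuous w} /\
           (forall t : R, t \in `[0, T] -> 0 <= w t)].

(* Functions on an interval are total functions [R -> R] whose values outside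
   the interval are irrelevant, so the derivative at the left endpoint 0 is the
   right derivative.  The requirement that [w] stay in [[0, wstar[] makes the
   right-hand side [g (f (w t))] meaningful. *)
Definition cauchy_solution (R : realType) (f g : R -> R) (wstar T : R)
    (w : R -> R) : Prop :=
  [/\ w 0 = 0,
      (forall t : R, t \in `[0, T[ -> w t \in `[0, wstar[),
      h^-1 * (w h - w 0) @[h --> 0^'+] --> g (f (w 0)) &
      (forall t : R, t \in `]0, T[ -> is_derive t 1 w (g (f (w t))))].

Fixpoint picard_iter (R : realType) (f g : R -> R) (n : nat) (t : R) : R :=
  if n is m.+1 then
    \int[lebesgue_measure]_(s in `[0, t]) g (f (picard_iter f g m s))
  else 0.

(* Main.v *)
(* Let phi = g o f and let F(x) be the integral of 1/phi over [0, x], the time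
   needed to reach x.  The solution is the inverse of F, extended by
   w(T) = wstar.  Monotonicity of phi turns every integral equation
   p(t) = int_0^t u into the two-sided increment bound
   u(s) (t - s) <= p(t) - p(s) <= u(t) (t - s).  These bounds are stable under
   pointwise limits, so no convergence theorem for integrals is needed, and they
   can be compared with each other by cutting the interval into small pieces.
   Such a comparison shows that the Picard iterates increase and stay below w,
   and that their limit v satisfies t <= F(v(t)), that is, w <= v. *)
Require Import Defs.
From mathcomp Require Import all_boot all_order all_algebra.
From mathcomp Require Import all_classical all_reals all_analysis.
From mathcomp Require Import lra ring.

Set Implicit Arguments.
Unset Strict Implicit.
Unset Printing Implicit Defensive.

Import Order.TTheory GRing.Theory Num.Theory.
Import numFieldNormedType.Exports.

Local Open Scope classical_set_scope.
Local Open Scope ring_scope.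

(** * Two general tools: limits through a function continuous only on a subset, and comparison of
    increments *)

Lemma within_cvg_comp (I : Type) (X Y : topologicalType) (F : set_system I)
    (FF : Filter F) (A : set X) (f : X -> Y) (u : I -> X) (x : X) :
  {within A, continuous f} -> A x -> (\forall i \near F, A (u i)) ->
  u i @[i --> F] --> x -> f (u i) @[i --> F] --> f x.
Proof.
move=> fc Ax Au ux P /fc fP.
have {}fP : within A (nbhs x) (f @^-1` P) by rewrite nbhs_subspace_in.
have fuP : \forall i \near F, A (u i) -> P (f (u i)) := ux _ fP.
by apply: filterS2 Au fuP => i Aui; exact.
Qed.

(* Cut [0, b] into n equal pieces: the increments of D add up to at most
   (u b - u 0) * b / n, which tends to 0. *)
Lemma increment_le_cross (R : archiRealFieldType) (b : R) (D u : R -> R) :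
    0 <= b ->
    (forall s t, 0 <= s -> s <= t -> t <= b ->
      D t - D s <= (u t - u s) * (t - s)) ->
  D b <= D 0.
Proof.
move=> b0 Du.
have bn (n : nat) : D b - D 0 <= (u b - u 0) * b / n.+1%:R.
  (* Induction over the cut points [b * k / n.+1]: the bounds telescope because every piece has the
     same length [b / n.+1]. *)
  have H k : (k <= n.+1)%N ->
    D (b * (k%:R / n.+1%:R)) - D 0 <=
      (u (b * (k%:R / n.+1%:R)) - u 0) * b / n.+1%:R.
    elim: k => [_|k IH kn]; first by rewrite !(mul0r,mulr0,subrr).
    have {}IH := IH (ltnW kn).
    set s := b * (k%:R / _) in IH *; set t := b * _.
    have ts : t - s = b / n.+1%:R.
      by rewrite /t /s -mulrBr -mulrBl -natr1 addrAC subrr add0r div1r.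
    have tb : t <= b.
      by rewrite /t ler_piMr// ler_pdivrMr ?ltr0Sn// mul1r ler_nat.
    have s0 : 0 <= s by rewrite mulr_ge0// divr_ge0.
    have st : s <= t by rewrite -subr_ge0 ts divr_ge0.
    have := Du _ _ s0 st tb; rewrite ts => h.
    rewrite -(subrK (D s) (D t)) -addrA.
    apply: (le_trans (lerD h IH)).
    by rewrite -!mulrA -mulrDl addrA subrK.
  by have := H _ (leqnn _); rewrite divff ?pnatr_eq0// mulr1.
rewrite -subr_le0; apply/ler_addgt0Pr => e e0; rewrite add0r.
set C := (u b - u 0) * b in bn.
have := truncnS_gt (C / e); set n := Num.Def.trunc _ => Cn.
apply: le_trans (bn n) _.
by rewrite ler_pdivrMr ?ltr0Sn// mulrC -ler_pdivrMr// ltW.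
Qed.

(** * Integrals of monotone functions *)

Section increments.
Context {R : realType}.
Notation mu := (@lebesgue_measure R).

Lemma integrable_nondecreasing (b : R) (u : R -> R) :
  {in `[0, b] &, {homo u : x y / x <= y}} ->
  mu.-integrable `[0, b] (EFin \o u).
Proof.
move=> u_mono; have [b0|b0] := leP 0 b; last first.
  by rewrite set_itv_ge -?leNgt ?bnd_simp -?ltNge//; exact: integrable_set0.
have b0' : 0 \in `[0, b] by rewrite in_itv/= lexx.
have bb' : b \in `[0, b] by rewrite in_itv/= lexx b0.
apply: measurable_bounded_integrable => //.
- by rewrite /= lebesgue_measure_itv/=; case: ifP => //; rewrite ltry.
(* [u] is monotone on the segment only. Clamping the argument with [c] gives a function monotone on
   the whole line, hence measurable, that agrees with [u] on the segment. *)
- pose c x : R := Num.max 0 (Num.min x b).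
  have cI x : c x \in `[0, b].
    by rewrite in_itv/= le_max lexx/= ge_max b0/= ge_min lexx orbT.
  apply: (@eq_measurable_fun _ _ _ _ _ (u \o c)).
    move=> x; rewrite inE/= in_itv/= => /andP[x0 xb].
    by rewrite /c min_l// max_r.
  apply: measurable_realfun.nondecreasing_measurable => // x y xy.
  apply: u_mono => //; rewrite /c.
  by rewrite ge_max !le_max !le_min !ge_min xy !lexx !orbT.
- exists (`|u 0| + `|u b|); split; first exact: num_real.
  move=> M ltM x /= xI; apply: (le_trans _ (ltW ltM)).
  have := xI; rewrite in_itv/= => /andP[x0 xb].
  rewrite ler_norml; apply/andP; split.
    rewrite lerNl; apply: (le_trans (_ : _ <= - u 0)).
      by rewrite lerN2; exact: u_mono.
    by rewrite (le_trans (ler_norm _))// normrN lerDl.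
  apply: (le_trans (_ : _ <= u b)); first exact: u_mono.
  by rewrite (le_trans (ler_norm _))// lerDr.
Qed.

Lemma Rintegral_increment (s t m M : R) (u : R -> R) : 0 <= s -> s <= t ->
  mu.-integrable `[0, t] (EFin \o u) ->
  (forall x, x \in `[s, t] -> m <= u x <= M) ->
  m * (t - s) <= \int[mu]_(x in `[0, t]) u x - \int[mu]_(x in `[0, s]) u x
    <= M * (t - s).
Proof.
move=> s0 st iu mM.
rewrite Rintegral_itvB ?bnd_simp//.
have sub : `]s, t] `<=` `[0, t].
  by apply: subset_itv; rewrite bnd_simp.
have iu' : mu.-integrable `]s, t] (EFin \o u) by apply: integrableS iu.
have ic c : mu.-integrable `]s, t] (EFin \o (fun=> c)).
  apply: (@integrableS _ _ _ mu `[0, t]) => //.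
  exact: integrable_nondecreasing.
have cE c : \int[mu]_(x in `]s, t]) c = c * (t - s).
  rewrite Rintegral_cst//= lebesgue_measure_itv/= lte_fin.
  move: st; rewrite le_eqVlt => /predU1P[->|->//].
  by rewrite ltxx subrr.
rewrite -!cE; apply/andP; split; apply: le_Rintegral => // x /=;
  rewrite in_itv/= => /andP[/ltW sx xt]; have := mM x;
  by rewrite in_itv/= sx xt/= => /(_ isT)/andP[].
Qed.

End increments.

(** * The travel time [F]: increments, range and inverse *)

Section autonomous_blow_up.
Context {R : realType}.
Notation mu := (@lebesgue_measure R).
Variables (phi : R -> R) (wstar T : R).
Hypothesis phi_mono : {in `[0, wstar[ &, {homo phi : x y / x <= y}}.
Hypothesis phi_cont : {within `[0, wstar[, continuous phi}.
Hypothesis wstar_gt0 : 0 < wstar.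
Hypothesis phi_gt0 : forall x, x \in `[0, wstar[ -> 0 < phi x.
Hypothesis phi_lim : phi x @[x --> wstar^'-] --> +oo.

Definition travel_time (x : R) : R := \int[mu]_(s in `[0, x]) (phi s)^-1.
Local Notation F := travel_time.

Hypothesis T_lim : F x @[x --> wstar^'-] --> T.

Let phi_le x y : 0 <= x -> x <= y -> y < wstar -> phi x <= phi y.
Proof.
move=> x0 xy yw; apply: phi_mono => //; rewrite in_itv/= ?x0 ?yw ?andbT.
  exact: le_lt_trans yw.
exact: le_trans xy.
Qed.

Let phi_pos x : 0 <= x -> x < wstar -> 0 < phi x.
Proof. by move=> x0 xw; apply: phi_gt0; rewrite in_itv/= x0. Qed.

Let phi_large A : exists x, [/\ 0 <= x, x < wstar & A < phi x].
Proof.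
have := phi_lim => /cvgryPgt/(_ A) phiA.
have : \forall x \near wstar^'-, [/\ 0 <= x, x < wstar & A < phi x].
  near=> x; split; near: x; [exact: nbhs_left_ge|exact: nbhs_left_lt|exact: phiA].
by move=> /filter_ex.
Unshelve. all: by end_near. Qed.

Let integrable_invphi b : b < wstar ->
  mu.-integrable `[0, b] (EFin \o (fun s => (phi s)^-1)).
Proof.
move=> bw.
(* [1 / phi] is nonincreasing, so integrability is proved for its opposite. *)
have := @integrable_nondecreasing R b (fun s => - (phi s)^-1).
move=> /(_ _)/integrableN; rewrite (_ : _ \o _ = EFin \o (fun s => (phi s)^-1)).
  apply=> x y; rewrite !in_itv/= => /andP[x0 xb] /andP[y0 yb] xy.
  have yw := le_lt_trans yb bw.
  rewrite lerN2 lef_pV2 ?posrE ?phi_pos ?phi_le//.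
  exact: le_lt_trans xy yw.
by apply/funext => x /=; rewrite opprK.
Qed.

Lemma travel_time_increment a b : 0 <= a -> a <= b -> b < wstar ->
  (phi b)^-1 * (b - a) <= F b - F a <= (phi a)^-1 * (b - a).
Proof.
move=> a0 ab bw; apply: Rintegral_increment => //.
  exact: integrable_invphi.
move=> x; rewrite in_itv/= => /andP[ax xb].
have x0 := le_trans a0 ax; have xw := le_lt_trans xb bw.
have aw := le_lt_trans ab bw; have b0 := le_trans a0 ab.
by rewrite !lef_pV2 ?posrE ?phi_pos ?phi_le.
Qed.

Lemma travel_time0 : F 0 = 0.
Proof. by rewrite /F set_itv1 Rintegral_set1. Qed.

Lemma travel_time_lt a b : 0 <= a -> a < b -> b < wstar -> F a < F b.
Proof.
move=> a0 ab bw; rewrite -subr_gt0.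
have /andP[+ _] := travel_time_increment a0 (ltW ab) bw.
apply: lt_le_trans; rewrite mulr_gt0 ?subr_gt0// invr_gt0 phi_pos//.
exact: le_trans (ltW ab).
Qed.

Lemma travel_time_le a b : 0 <= a -> a <= b -> b < wstar -> F a <= F b.
Proof.
move=> a0; rewrite le_eqVlt => /predU1P[->//|ab bw].
exact/ltW/travel_time_lt.
Qed.

Lemma travel_time_ge0 x : 0 <= x -> x < wstar -> 0 <= F x.
Proof. by move=> x0 xw; rewrite -travel_time0 travel_time_le. Qed.

Lemma travel_time_ltT x : 0 <= x -> x < wstar -> F x < T.
Proof.
(* The limit only yields [F y <= T]; strictness comes from [F x < F y] at an intermediate [y]. *)
move=> x0 xw; have [y /andP[xy yw]] : exists y, x < y < wstar.
  by exists ((x + wstar) / 2); rewrite !midf_lt.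
have y0 := le_trans x0 (ltW xy).
apply: (lt_le_trans (travel_time_lt x0 xy yw)).
apply: (cvgr_to_ge T_lim); near=> z.
have yz : y <= z by near: z; exact: nbhs_left_ge.
have zw : z < wstar by near: z; exact: nbhs_left_lt.
exact: travel_time_le.
Unshelve. all: by end_near. Qed.

(** The limit at [wstar] of the upper increment bound for [F]. It is used to keep the Picard
    iterates below [wstar] at the final time. *)
Lemma remaining_time_le x : 0 <= x -> x < wstar ->
  T - F x <= (phi x)^-1 * (wstar - x).
Proof.
move=> x0 xw; rewrite lerBlDr; apply: (cvgr_to_le T_lim); near=> z.
have xz : x <= z by near: z; exact: nbhs_left_ge.
have zw : z < wstar by near: z; exact: nbhs_left_lt.
rewrite -lerBlDr; have /andP[_ /le_trans] := travel_time_increment x0 xz zw.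
by apply; rewrite ler_wpM2l ?invr_ge0 ?lerB// ltW ?phi_pos// ltW.
Unshelve. all: by end_near. Qed.

Lemma travel_time_surj t : 0 <= t -> t < T ->
  exists x, [/\ 0 <= x, x < wstar & F x = t].
Proof.
move=> t0 tT.
have [z [z0 zw tz]] : exists z, [/\ 0 <= z, z < wstar & t < F z].
  suff /filter_ex : \forall z \near wstar^'-, [/\ 0 <= z, z < wstar & t < F z].
    by [].
  near=> z; split; near: z;
    [exact: nbhs_left_ge|exact: nbhs_left_lt|exact: (cvgr_gt _ T_lim)].
have [||x] := @IVT R F 0 z t z0.
- by apply: parameterized_integral_continuous => //; exact: integrable_invphi.
- by rewrite travel_time0 min_l ?max_r ?t0 ?ltW// (le_lt_trans t0).
- rewrite in_itv/= => /andP[x0 xz] Fx; exists x; split => //.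
  exact: le_lt_trans zw.
Unshelve. all: by end_near. Qed.

Lemma travel_time_inverse : exists w : R -> R,
  [/\ forall t, 0 <= t -> t < T -> [/\ 0 <= w t, w t < wstar & F (w t) = t] &
      w T = wstar].
Proof.
have /choice[w wP] t : exists x,
    (0 <= t -> t < T -> [/\ 0 <= x, x < wstar & F x = t]).
  have [/andP[t0 tT]|tT] := boolP (0 <= t < T).
    by have [x xP] := travel_time_surj t0 tT; exists x.
  by exists 0 => t0 t1; move: tT; rewrite t0 t1.
(* [F] stays below [T] on [[0, wstar[], so no point there corresponds to time [T], and the value at
   [T] is prescribed by hand. *)
exists (fun t => if t == T then wstar else w t); split; last by rewrite eqxx.
by move=> t t0 tT; rewrite lt_eqF//; exact: wP.
Qed.

(** * The inverse of the travel time solves the Cauchy problem *)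

Variable w : R -> R.
Hypothesis wP : forall t, 0 <= t -> t < T ->
  [/\ 0 <= w t, w t < wstar & F (w t) = t].
Hypothesis wT : w T = wstar.

Let T_gt0 : 0 < T.
Proof. by rewrite -travel_time0 travel_time_ltT. Qed.

Lemma inverse_travel_timeK x : 0 <= x -> x < wstar -> w (F x) = x.
Proof.
move=> x0 xw; have [] := wP (travel_time_ge0 x0 xw) (travel_time_ltT x0 xw).
set y := w _ => y0 yw yx; have [yltx|xlty|//] := ltgtP y x.
  by have := travel_time_lt y0 yltx xw; rewrite yx ltxx.
by have := travel_time_lt x0 xlty yw; rewrite yx ltxx.
Qed.

Let w0 : w 0 = 0.
Proof. by rewrite -[X in w X]travel_time0 inverse_travel_timeK. Qed.

Lemma inverse_travel_time_lt s t : 0 <= s -> s < t -> t <= T -> w s < w t.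
Proof.
move=> s0 st; rewrite le_eqVlt => /predU1P[tT|tT].
  by move: st; rewrite tT wT => /(wP s0)[].
have [ws0 wsw Fs] := wP s0 (lt_trans st tT).
have [wt0 wtw Ft] := wP (le_trans s0 (ltW st)) tT.
rewrite ltNge; apply/negP => /(travel_time_le wt0)/(_ wsw).
by rewrite Fs Ft leNgt st.
Qed.

(** These are the bounds for [F] between [w s] and [w t], where the increment of [F] is [t - s],
    solved for [w t - w s]. Both regularity at 0 and differentiability inside follow from them. *)
Lemma inverse_travel_time_increment s t : 0 <= s -> s <= t -> t < T ->
  phi (w s) * (t - s) <= w t - w s <= phi (w t) * (t - s).
Proof.
move=> s0; rewrite le_eqVlt => /predU1P[->|st tT].
  by rewrite !subrr !mulr0 lexx.
have [ws0 wsw Fs] := wP s0 (lt_trans st tT).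
have [wt0 wtw Ft] := wP (le_trans s0 (ltW st)) tT.
have wst := ltW (inverse_travel_time_lt s0 st (ltW tT)).
have := travel_time_increment ws0 wst wtw; rewrite Fs Ft.
by rewrite !(mulrC _^-1) ler_pdivrMr ?ler_pdivlMr ?phi_pos// !(mulrC (phi _)) andbC.
Qed.

(** A strictly increasing map of one segment onto another is continuous. The preimage of [x < wstar]
    is [F x], that of [wstar] is [T]. *)
Lemma inverse_travel_time_continuous : {within `[0, T], continuous w}.
Proof.
apply: segment_inc_surj_continuous.
  move=> s t; rewrite !in_itv/= => /andP[s0 sT] /andP[t0 tT].
  have [st|ts|->] := ltgtP s t; last by rewrite !lexx.
    by rewrite !ltW// inverse_travel_time_lt.
  by rewrite !leNgt inverse_travel_time_lt// ts.
move=> x /=; rewrite w0 wT in_itv/= => /andP[x0].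
rewrite le_eqVlt => /predU1P[->|xw].
  by exists T => //=; rewrite in_itv/= lexx ltW.
exists (F x); last exact: inverse_travel_timeK.
by rewrite /= in_itv/= travel_time_ge0//= ltW ?travel_time_ltT.
Qed.

Let w_itv t : 0 <= t -> t < T -> `[0, wstar[%classic (w t).
Proof. by move=> t0 tT; rewrite /= in_itv/=; have [-> ->] := wP t0 tT. Qed.

Lemma inverse_travel_time_derive0 :
  h^-1 * (w h - w 0) @[h --> 0^'+] --> phi (w 0).
Proof.
have [_ w_right _] := (continuous_within_itvP _ T_gt0).1
  inverse_travel_time_continuous.
have phiw : phi (w h) @[h --> 0^'+] --> phi (w 0).
  apply: (within_cvg_comp _ phi_cont) w_right; first exact: w_itv.
  by near=> h; apply: w_itv.
(* The increment bounds put the quotient between [phi (w 0)] and [phi (w h)]. *)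
apply: (squeeze_cvgr _ (cvg_cst (phi (w 0))) phiw).
near=> h.
have h0 : 0 < h by [].
have hT : h < T by near: h; exact: nbhs_right_lt.
rewrite mulrC ler_pdivlMr// ler_pdivrMr//.
by have := inverse_travel_time_increment (lexx 0) (ltW h0) hT; rewrite subr0.
Unshelve. all: by end_near. Qed.

Lemma inverse_travel_time_derive t : 0 < t -> t < T -> is_derive t 1 w (phi (w t)).
Proof.
move=> t0 tT.
have tI : t \in `]0, T[ by rewrite in_itv/= t0.
have wc := within_continuous_continuous T_gt0 inverse_travel_time_continuous tI.
have ht : h + t @[h --> 0^'] --> t.
  rewrite -[X in _ --> X]add0r; apply: cvgD; last exact: cvg_cst.
  exact: cvg_within.
have near_itv : \forall h \near 0^', 0 < h + t < T.
  by near=> h; apply/andP; split; near: h;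
    [exact: cvgr_gt ht _ t0|exact: cvgr_lt ht _ tT].
have wtc : w (h + t) @[h --> 0^'] --> w t by exact: cvg_comp ht wc.
have phiw : phi (w (h + t)) @[h --> 0^'] --> phi (w t).
  apply: (within_cvg_comp _ phi_cont) wtc; first exact/w_itv/tT/ltW.
  by apply: filterS near_itv => h /andP[h0 hT]; apply: w_itv => //; exact: ltW.
have quotient : h^-1 *: ((w \o shift t) (h *: 1) - w t) @[h --> 0^'] --> phi (w t).
  apply/cvgrPdist_lt => e e0; near=> h.
  have /andP[h0 hT] : 0 < h + t < T by near: h; exact: near_itv.
  have hn0 : h != 0 by near: h; exact: nbhs_dnbhs_neq.
  have : `|phi (w t) - phi (w (h + t))| < e.
    by near: h; exact: cvgr_dist_lt phiw _ e0.
  apply: le_lt_trans; rewrite /= -[h *: 1]/(h * 1) mulr1.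
  rewrite -[_ *: _]/(h^-1 * (w (h + t) - w t)).
  (* The quotient lies between [phi (w t)] and [phi (w (h + t))], in an order given by the sign of
     [h]; either way its distance to [phi (w t)] is at most that between these two values. *)
  have [hneg|hpos|heq] := ltgtP h 0; last by rewrite heq eqxx in hn0.
  - have ht' : h + t <= t by rewrite gerDr ltW.
    have := inverse_travel_time_increment (ltW h0) ht' tT.
    rewrite opprD addrCA subrr addr0 => /andP[].
    rewrite -ler_pdivlMr ?oppr_gt0// => bq; rewrite -ler_pdivrMr ?oppr_gt0// => qa.
    have qE : (w t - w (h + t)) / - h = h^-1 * (w (h + t) - w t) by field.
    rewrite qE in bq qa.
    by rewrite !ger0_norm ?subr_ge0// ?lerB// (le_trans bq).
  - have ht' : t <= h + t by rewrite lerDr ltW.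
    have := inverse_travel_time_increment (ltW t0) ht' hT.
    rewrite addrK => /andP[]; rewrite -ler_pdivlMr// mulrC => aq.
    rewrite -ler_pdivrMr// mulrC => qb.
    by rewrite !ler0_norm ?subr_le0// ?lerN2 ?lerB// (le_trans aq).
apply: DeriveDef; first by apply/cvg_ex; exists (phi (w t)).
exact: cvg_lim quotient.
Unshelve. all: by end_near. Qed.

(** If [phi x > A], then after time [F x] the solution has passed [x], so its derivative [phi (w t)]
    exceeds [A]. *)
Lemma inverse_travel_time_derive_blow_up : derive1 w t @[t --> T^'-] --> +oo.
Proof.
apply/cvgryPgt => A; have [x [x0 xw Ax]] := phi_large A.
near=> t.
have Fxt : F x < t.
  by near: t; apply: nbhs_left_gt; exact: travel_time_ltT.
have tT : t < T by [].
have t0 : 0 < t by apply: le_lt_trans Fxt; exact: travel_time_ge0.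
rewrite derive1E (@derive_val _ _ _ _ _ _ _ (inverse_travel_time_derive t0 tT)).
have [_ wtw _] := wP (ltW t0) tT.
apply: (lt_le_trans Ax); apply: phi_le => //.
rewrite -[leLHS]inverse_travel_timeK// ltW// inverse_travel_time_lt ?travel_time_ge0//.
Unshelve. all: by end_near. Qed.

(** * One Picard step and the invariant it preserves *)

Definition picard_step (p : R -> R) (t : R) : R :=
  \int[mu]_(s in `[0, t]) phi (p s).

(** The invariant of the iteration. The strict bound at [T] is a separate clause because comparison
    with [w] gives at most [wstar] there, where [phi] is not controlled. *)
Definition subsolution (p : R -> R) : Prop :=
  [/\ p 0 = 0,
      forall s t, 0 <= s -> s <= t -> t <= T -> p s <= p t,
      forall t, 0 <= t -> t < T -> p t <= w t &
      p T < wstar].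

Lemma subsolution_itv p t : subsolution p -> 0 <= t -> t <= T ->
  0 <= p t /\ p t < wstar.
Proof.
move=> [p0 p_mono _ pT] t0 tT; split; first by rewrite -p0 p_mono.
by apply: le_lt_trans pT; rewrite p_mono.
Qed.

Lemma picard_step_increment p s t : subsolution p ->
  0 <= s -> s <= t -> t <= T ->
  phi (p s) * (t - s) <= picard_step p t - picard_step p s
    <= phi (p t) * (t - s).
Proof.
move=> subp s0 st tT; have [p0 p_mono _ pT] := subp.
have phip_le x y : 0 <= x -> x <= y -> y <= T -> phi (p x) <= phi (p y).
  move=> x0 xy yT.
  have [px0 _] := subsolution_itv subp x0 (le_trans xy yT).
  have [_ py] := subsolution_itv subp (le_trans x0 xy) yT.
  by rewrite phi_le ?p_mono.
apply: Rintegral_increment => //.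
  apply: (@integrable_nondecreasing _ t (phi \o p)) => x y.
  rewrite !in_itv/= => /andP[x0 _] /andP[_ yt] xy.
  by rewrite phip_le// (le_trans yt).
move=> x; rewrite in_itv/= => /andP[sx xt].
by rewrite !phip_le ?(le_trans s0 sx)// (le_trans xt).
Qed.

Lemma picard_step0 p : picard_step p 0 = 0.
Proof. by rewrite /picard_step set_itv1 Rintegral_set1. Qed.

Lemma picard_step_subsolution p : subsolution p -> subsolution (picard_step p).
Proof.
move=> subp; have [p0 p_mono p_le pT] := subp.
have q_le t : 0 <= t -> t < T -> picard_step p t <= w t.
  move=> t0 tT.
  suff : picard_step p t - w t <= picard_step p 0 - w 0.
    by rewrite picard_step0 w0 subrr subr_le0.
  (* On a piece from [x] to [y] the step gains at most [phi (p y) * (y - x)], hence at most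
     [phi (w y) * (y - x)], while [w] gains at least [phi (w x) * (y - x)]. *)
  apply: (@increment_le_cross _ t (fun x => picard_step p x - w x) (phi \o w)) => //.
  move=> x y x0 xy yt; have yT := le_lt_trans yt tT; have y0 := le_trans x0 xy.
  have /andP[_ qxy] := picard_step_increment subp x0 xy (ltW yT).
  have /andP[wxy _] := inverse_travel_time_increment x0 xy yT.
  have [_ wyw _] := wP y0 yT.
  have [py0 _] := subsolution_itv subp y0 (ltW yT).
  have : phi (p y) * (y - x) <= phi (w y) * (y - x).
    by rewrite ler_wpM2r ?subr_ge0// phi_le ?p_le.
  by rewrite /= mulrBl; lra.
split => //; first exact: picard_step0.
- move=> s t s0 st tT; rewrite -subr_ge0.
  have /andP[+ _] := picard_step_increment subp s0 st tT.
  apply: le_trans; rewrite mulr_ge0 ?subr_ge0// ltW//.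
  by have [? ?] := subsolution_itv subp s0 (le_trans st tT); exact: phi_pos.
(* With [phi x > phi (p T)]: at time [F x] the step is at most [x], afterwards its slope is at most
   [phi (p T)], and a slope of [phi x] during the remaining time [T - F x] would gain at most
   [wstar - x]. *)
- have [x [x0 xw Mx]] := phi_large (phi (p T)).
  have FT := travel_time_ltT x0 xw; have F0 := travel_time_ge0 x0 xw.
  have /andP[_ qT] := picard_step_increment subp F0 (ltW FT) (lexx T).
  have := q_le _ F0 FT; rewrite inverse_travel_timeK// => qF.
  have := remaining_time_le x0 xw; rewrite mulrC ler_pdivlMr ?phi_pos// mulrC.
  have : phi (p T) * (T - F x) < phi x * (T - F x) by rewrite ltr_pM2r ?subr_gt0.
  lra.
Qed.

(** The same cutting argument: the upper increment bound for [p] against the lower one for [q]. *)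
Lemma picard_step_le p q : subsolution p -> subsolution q ->
  (forall t, 0 <= t -> t <= T -> p t <= q t) ->
  forall t, 0 <= t -> t <= T -> picard_step p t <= picard_step q t.
Proof.
move=> subp subq pq t t0 tT.
suff : picard_step p t - picard_step q t <= picard_step p 0 - picard_step q 0.
  by rewrite !picard_step0 subrr subr_le0.
apply: (@increment_le_cross _ t (fun x => picard_step p x - picard_step q x)
  (phi \o q)) => //.
move=> x y x0 xy yt; have yT := le_trans yt tT; have y0 := le_trans x0 xy.
have /andP[_ pxy] := picard_step_increment subp x0 xy yT.
have /andP[qxy _] := picard_step_increment subq x0 xy yT.
have [py0 _] := subsolution_itv subp y0 yT.
have [_ qyw] := subsolution_itv subq y0 yT.
have : phi (p y) * (y - x) <= phi (q y) * (y - x).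
  by rewrite ler_wpM2r ?subr_ge0// phi_le ?pq.
by rewrite /= mulrBl; lra.
Qed.

(** * Monotone convergence of the Picard iterates to [w] *)

Variable P : nat -> R -> R.
Hypothesis P0 : forall t, P 0 t = 0.
Hypothesis PS : forall n t, P n.+1 t = picard_step (P n) t.

Lemma picard_subsolution n : subsolution (P n).
Proof.
elim: n => [|n IH].
  split=> [|s t _ _ _|t t0 tT|]; rewrite ?P0//.
  by have [] := wP t0 tT.
by rewrite (_ : P n.+1 = picard_step (P n)) ?funeqE//; exact: picard_step_subsolution.
Qed.

Lemma picard_nondecreasing t : 0 <= t -> t <= T ->
  nondecreasing_seq (fun n => P n t).
Proof.
move=> t0 tT; apply/nondecreasing_seqP => n.
elim: n t t0 tT => [|n IH] t t0 tT.
  by rewrite P0; have [] := subsolution_itv (picard_subsolution 1) t0 tT.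
by rewrite !PS; apply: picard_step_le => //; exact: picard_subsolution.
Qed.

Lemma picard_le n t : 0 <= t -> t <= T -> P n t <= w t.
Proof.
move=> t0; have [_ _ P_le PT] := picard_subsolution n.
rewrite le_eqVlt => /predU1P[->|]; last exact: P_le.
by rewrite wT ltW.
Qed.

Lemma picard_cvg : forall t, 0 <= t -> t <= T -> P n t @[n --> \oo] --> w t.
Proof.
pose v t := limn (fun n => P n t).
have Pv s : 0 <= s -> s <= T -> P n s @[n --> \oo] --> v s.
  move=> s0 sT; apply: nondecreasing_is_cvgn; first exact: picard_nondecreasing.
  by exists (w s) => _ [n _ <-]; exact: picard_le.
have vw s : 0 <= s -> s <= T -> v s <= w s.
  by move=> s0 sT; apply: (cvgr_to_le (Pv _ s0 sT)); near=> n; exact: picard_le.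
have v_itv s : 0 <= s -> s < T -> 0 <= v s /\ v s < wstar.
  move=> s0 sT; split; last first.
    by apply: (le_lt_trans (vw s s0 (ltW sT))); have [] := wP s0 sT.
  apply: (cvgr_to_ge (Pv _ s0 (ltW sT))); near=> n.
  by have [] := subsolution_itv (picard_subsolution n) s0 (ltW sT).
have phiPv s : 0 <= s -> s < T -> phi (P n s) @[n --> \oo] --> phi (v s).
  move=> s0 sT; apply: (within_cvg_comp _ phi_cont) (Pv _ s0 (ltW sT)).
    by rewrite /= in_itv/=; have [-> ->] := v_itv s s0 sT.
  near=> n; rewrite /= in_itv/=.
  by have [-> ->] := subsolution_itv (picard_subsolution n) s0 (ltW sT).
have v0 : v 0 = 0.
  apply/eqP; rewrite eq_le; have [-> _] := v_itv 0 (lexx 0) T_gt0.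
  by have := vw 0 (lexx 0) (ltW T_gt0); rewrite w0 => ->.
(* The lower increment bound survives the limit; the shift from [P n] to [P n.+1] does not affect
   it. *)
have v_incr s t : 0 <= s -> s <= t -> t < T ->
    phi (v s) * (t - s) <= v t - v s.
  move=> s0 st tT; have t0 := le_trans s0 st; have sT := le_lt_trans st tT.
  have lhs : phi (P n s) * (t - s) @[n --> \oo] --> phi (v s) * (t - s).
    by apply: cvgMl; exact: phiPv.
  have rhs : P n.+1 t - P n.+1 s @[n --> \oo] --> v t - v s.
    by apply: cvgB; rewrite (cvg_shiftS (fun n => P n _)); apply: Pv => //; exact: ltW.
  apply: (ler_cvg_to lhs rhs); near=> n; rewrite !PS.
  by have /andP[] := picard_step_increment (picard_subsolution n) s0 st (ltW tT).
have v_mono s t : 0 <= s -> s <= t -> t <= T -> v s <= v t.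
  move=> s0 st tT; apply: (ler_cvg_to (Pv _ s0 (le_trans st tT))
    (Pv _ (le_trans s0 st) tT)).
  by near=> n; have [_ P_mono _ _] := picard_subsolution n; exact: P_mono.
have wv s : 0 <= s -> s < T -> w s <= v s.
  move=> s0 sT; have [vs0 vsw] := v_itv s s0 sT.
  have [ws0 wsw Fs] := wP s0 sT.
  rewrite leNgt; apply/negP => vltw.
  (* This says [s <= F (v s)], whereas [v s < w s] would give [F (v s) < F (w s) = s]. *)
  suff : s - F (v s) <= 0 - F (v 0).
    rewrite v0 travel_time0 subr0 subr_le0.
    by rewrite -{1}Fs leNgt travel_time_lt.
  (* By [v_incr], [F \o v] gains at least [phi (v x) / phi (v y) * (y - x)]. The defect
     [1 - phi (v x) / phi (v y)] is at most [(phi (v y) - phi (v x)) / phi 0], an increment of a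
     fixed function. *)
  apply: (@increment_le_cross _ s (fun x => x - F (v x))
    (fun x => phi (v x) / phi 0)) => //.
  move=> x y x0 xy ys; have yT := le_lt_trans ys sT; have y0 := le_trans x0 xy.
  have xT := le_lt_trans xy yT.
  have [vx0 vxw] := v_itv x x0 xT; have [vy0 vyw] := v_itv y y0 yT.
  have vxy := v_mono x y x0 xy (ltW yT).
  have /andP[Fxy _] := travel_time_increment vx0 vxy vyw.
  have vxyi := v_incr x y x0 xy yT.
  have phi0 := phi_pos (lexx 0) wstar_gt0.
  have phi0y := phi_le (lexx 0) vy0 vyw.
  have phixy := phi_le vx0 vxy vyw.
  have phiy := phi_pos vy0 vyw.
  have dF : phi (v x) / phi (v y) * (y - x) <= F (v y) - F (v x).
    by apply: le_trans Fxy; rewrite mulrAC mulrC ler_wpM2l// invr_ge0 ltW.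
  have : (1 - phi (v x) / phi (v y)) * (y - x) <=
      (phi (v y) / phi 0 - phi (v x) / phi 0) * (y - x).
    rewrite ler_wpM2r ?subr_ge0// -{1}(divff (lt0r_neq0 phiy)) -!mulrBl.
    by rewrite ler_wpM2l ?subr_ge0// lef_pV2.
  by rewrite /= mulrBl mul1r; lra.
move=> t t0; rewrite le_eqVlt => /predU1P[tT|tT].
  rewrite tT; suff <- : v T = w T by apply: Pv => //; exact: ltW.
  apply/eqP; rewrite eq_le vw//= ?wT; last exact: ltW.
  (* If [v T < wstar], then [w] reaches [v T] at time [F (v T) < T] and exceeds it at a later
     [s < T], against [w s <= v s <= v T]. *)
  rewrite leNgt; apply/negP => vtw.
  have vt0 : 0 <= v T by rewrite -v0 v_mono// ltW.
  have FT := travel_time_ltT vt0 vtw; have F0 := travel_time_ge0 vt0 vtw.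
  have [Fs sT] := (midf_lt FT, midf_lt FT); set s := (_ + _) / 2 in Fs sT.
  have s0 : 0 <= s by rewrite (le_trans F0)// ltW// Fs.
  have := inverse_travel_time_lt F0 Fs.1 (ltW sT.2).
  rewrite inverse_travel_timeK// ltNge => /negP; apply.
  by rewrite (le_trans (wv _ s0 sT.2))// v_mono// ltW// sT.2.
suff <- : v t = w t by apply: Pv => //; exact: ltW.
by apply/eqP; rewrite eq_le wv// vw// ltW.
Unshelve. all: by end_near. Qed.

End autonomous_blow_up.

(** * Specialization to [phi = g \o f] *)

Theorem lemma3 (R : realType) (f g : R -> R) (wstar T : R)
  (f_mono : {in `[0, wstar[ &, {homo f : x y / x <= y}})
  (f_cont : {within `[0, wstar[, continuous f})
  (g_mono : {in f @` `[0, wstar[ &, {homo g : x y / x <= y}})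
  (g_cont : {within f @` `[0, wstar[, continuous g})
  (wstar_gt0 : 0 < wstar)
  (gf_cont : {within `[0, wstar[, continuous (g \o f)})
  (gf_gt0 : forall w : R, w \in `[0, wstar[ -> 0 < g (f w))
  (gf_lim : g (f w) @[w --> wstar^'-] --> +oo)
  (T_lim : \int[lebesgue_measure]_(s in `[0, w]) (g (f s))^-1
             @[w --> wstar^'-] --> T) :
  exists w : R -> R,
    [/\ w \in nonneg_cone T,
        {in `[0, T] &, {homo w : s t / s < t}},
        cauchy_solution f g wstar T w,
        derive1 w t @[t --> T^'-] --> +oo &
        (forall (n : nat) (t : R), t \in `[0, T] -> picard_iter f g n t \in `[0, wstar[) /\
        (forall t : R, t \in `[0, T] -> picard_iter f g n t @[n --> \oo] --> w t)].
Proof.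
have phi_mono : {in `[0, wstar[ &, {homo g \o f : x y / x <= y}}.
  move=> x y xI yI xy; apply: g_mono; last exact: f_mono.
    by apply/mem_set; exists x.
  by apply/mem_set; exists y.
have phi_gt0 x : x \in `[0, wstar[ -> 0 < (g \o f) x by exact: gf_gt0.
have [w [wP wT]] :=
  travel_time_inverse phi_mono wstar_gt0 phi_gt0 T_lim.
have T_gt0 : 0 < T.
  rewrite -(travel_time0 (g \o f)).
  exact: (travel_time_ltT phi_mono phi_gt0 T_lim).
have w_lt s t : 0 <= s -> s < t -> t <= T -> w s < w t.
  exact: (inverse_travel_time_lt phi_mono phi_gt0 wP wT).
have w_ge0 t : t \in `[0, T] -> 0 <= w t.
  rewrite in_itv/= => /andP[t0]; rewrite le_eqVlt => /predU1P[->|tT].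
    by rewrite wT ltW.
  by have [] := wP t t0 tT.
have PS n t : picard_iter f g n.+1 t = picard_step (g \o f) (picard_iter f g n) t.
  by [].
exists w; split.
- apply/mem_set; split => //.
  exact: (inverse_travel_time_continuous phi_mono wstar_gt0 phi_gt0 T_lim wP wT).
- move=> s t; rewrite !in_itv/= => /andP[s0 _] /andP[_ tT] st.
  exact: w_lt.
- split.
  + rewrite -[X in w X](travel_time0 (g \o f)).
    exact: (inverse_travel_timeK phi_mono phi_gt0 T_lim wP).
  + move=> t; rewrite !in_itv/= => /andP[t0 tT].
    by have [-> ->] := wP t t0 tT.
  + exact: (inverse_travel_time_derive0 phi_mono gf_cont wstar_gt0 phi_gt0 T_lim wP wT).
  + move=> t; rewrite in_itv/= => /andP[t0 tT].
    exact: (inverse_travel_time_derive phi_mono gf_cont wstar_gt0 phi_gt0 T_lim wP wT).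
- exact: (inverse_travel_time_derive_blow_up phi_mono gf_cont wstar_gt0 phi_gt0 gf_lim T_lim wP wT).
- split=> [n t|t]; rewrite !in_itv/= => /andP[t0 tT].
    (* The invariant also shows that each iterate stays where [g \o f] is defined, including at
       [t = T]. *)
    have subn : subsolution wstar T w (picard_iter f g n).
      exact: (picard_subsolution phi_mono wstar_gt0 phi_gt0 gf_lim T_lim wP wT _ PS).
    by have [-> ->] := subsolution_itv subn t0 tT.
  exact: (picard_cvg phi_mono gf_cont wstar_gt0 phi_gt0 gf_lim T_lim wP wT _ PS).
Qed.
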